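(* Let $\{x^k\}_{k\ge1}$ be generated by the block stochastic gradient (BSG) method (described in the context) applied to the smooth unconstrained problem $\min_{x\in\mathbb R^n}\Phi(x)=F(x)$ (no convexity is assumed), with stepsizes $\alpha_i^k=c_i^k\beta_k$, where $c_i^k,\beta_k$ are positive scalars such that $\beta_k\ge\beta_{k+1}$ for all $k$, $$0<\inf_kc_i^k\le\sup_kc_i^k<\infty\quad\text{for all }i,\qquad\sum_{k=1}^\infty\beta_k=+\infty,\qquad\sum_{k=1}^\infty\beta_k^2<+\infty.$$ Assume: (1) there are a constant $A$ and a sequence $\{\sigma_k\}$ such that for all $i,k$: $\big\|\mathbb E[\delta_i^k\mid\mathbf\Xi_{[k-1]}]\big\|\le A\max_j\alpha_j^k$ and $\mathbb E\|\delta_i^k\|^2\le\sigma_k^2$; (2) $\Phi$ is bounded below, and there is $L>0$ such that $\|\nabla_{x_i}F(x)-\nabla_{x_i}F(y)\|\le L\|x-y\|$ for all $x,y$ and all $i$; (3) there is a constant $\rho$ such that $\mathbb E\|x^k\|^2\le\rho^2$ for all $k$. If $\sigma:=\sup_k\sigma_k<\infty$, then $$\lim_{k\to\infty}\mathbb E\|\nabla\Phi(x^k)\|=\lim_{k\to\infty}\mathbb E\|\nabla F(x^k)\|=0.$$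
   Context: Setting. $F(x)=\mathbb E_\xi f(x;\xi)$ is continuously differentiable on $\mathbb R^n$, where $\xi$ is a random variable and $x=(x_1,\dots,x_s)\in\mathbb R^n$ is partitioned into blocks $x_i\in\mathbb R^{n_i}$. $\|\cdot\|$ is the Euclidean norm, $x_{<i}=(x_1,\dots,x_{i-1})$, and similarly $x_{\ge i}$; $\nabla_{x_i}$ is the partial gradient in block $i$. BSG method (for no regularizers and no constraints). Given a deterministic starting point $x^1$, positive deterministic stepsizes $\alpha_i^k$, and positive integers $m_k$: at iteration $k=1,2,\dots$ draw a random mini-batch $\Xi_k=\{\xi_{k,1},\dots,\xi_{k,m_k}\}$ of samples of $\xi$; then for $i=1,\dots,s$ in this order compute $$\tilde g_i^k=\frac1{m_k}\sum_{\ell=1}^{m_k}\nabla_{x_i}f(x_{<i}^{k+1},x_{\ge i}^k;\xi_{k,\ell})$$ and set $$x_i^{k+1}=\arg\min_{x_i}\ \langle\tilde g_i^k,x_i-x_i^k\rangle+\tfrac1{2\alpha_i^k}\|x_i-x_i^k\|^2=x_i^k-\alpha_i^k\tilde g_i^k.$$ Notation: $g_i^k=\nabla_{x_i}F(x_{<i}^{k+1},x_{\ge i}^k)$, $\delta_i^k=\tilde g_i^k-g_i^k$, $\mathbf\Xi_{[k]}=(\Xi_1,\dots,\Xi_k)$; $\mathbb E[\cdot\mid\cdot]$ is conditional expectation. *)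

(* Defs.v *)
From HB Require Import structures.
From mathcomp Require Import all_boot all_order all_algebra.
From mathcomp Require Import all_classical all_reals all_analysis.
From mathcomp Require Import ring lra.
Set Implicit Arguments.
Unset Strict Implicit.
Unset Printing Implicit Defensive.
Import Order.TTheory GRing.Theory Num.Theory.
Import numFieldNormedType.Exports.
Local Open Scope classical_set_scope.
Local Open Scope ring_scope.

Section Euclidean.
Context {R : realType}.

Definition dotv n (u v : 'rV[R]_n) : R := \sum_j u 0 j * v 0 j.

(* The norm `|v| of the library on row vectors is the sup norm. *)
Definition enorm n (v : 'rV[R]_n) : R := Num.sqrt (\sum_j v 0 j ^+ 2).

Definition gradient n (h : 'rV[R]_n -> R) (x : 'rV[R]_n) : 'rV[R]_n :=
  \row_j 'D_(delta_mx 0 j) h x.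

(* [is_argmin] is only used for strictly convex functions, for which a minimizer
   is unique; see [prox_stepP]. *)
Definition is_argmin (T : Type) (h : T -> R) (z : T) : Prop :=
  forall y, h z <= h y.

Definition prox_linear n (g x : 'rV[R]_n) (a : R) (y : 'rV[R]_n) : R :=
  dotv g (y - x) + (2 * a)^-1 * enorm (y - x) ^+ 2.

Lemma prox_linearE n (g x : 'rV[R]_n) (a : R) (y : 'rV[R]_n) : 0 < a ->
  prox_linear g x a y =
  (2 * a)^-1 * enorm (y - (x - a *: g)) ^+ 2 - a / 2 * enorm g ^+ 2.
Proof.
move=> a0; rewrite /prox_linear /enorm.
rewrite !sqr_sqrtr; do ?by apply: sumr_ge0 => j _; exact: sqr_ge0.
rewrite /dotv !mulr_sumr -big_split -sumrB /=.
apply: eq_bigr => j _; rewrite !mxE; field.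
exact: lt0r_neq0.
Qed.

Lemma prox_stepP n (g x : 'rV[R]_n) (a : R) (z : 'rV[R]_n) : 0 < a ->
  is_argmin (prox_linear g x a) z <-> z = x - a *: g.
Proof.
move=> a0; have a20 : 0 < (2 * a)^-1 by rewrite invr_gt0 mulr_gt0.
split=> [zmin | -> y]; last first.
  rewrite !prox_linearE // lerD2r ler_pM2l // subrr {1}/enorm.
  rewrite big1 ?sqrtr0 ?expr0n ?sqr_ge0 //.
  by move=> j _; rewrite mxE expr0n.
have := zmin (x - a *: g).
rewrite !prox_linearE // lerD2r ler_pM2l // subrr.
have -> : enorm (0 : 'rV[R]_n) = 0.
  by rewrite /enorm big1 ?sqrtr0 // => j _; rewrite mxE expr0n.
rewrite expr0n /= /enorm sqr_sqrtr; last first.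
  by apply: sumr_ge0 => j _; exact: sqr_ge0.
move=> le0; apply/eqP; rewrite -subr_eq0; apply/eqP/rowP => j.
have /eqP : \sum_j (z - (x - a *: g)) 0 j ^+ 2 = 0.
  by apply/le_anti; rewrite le0 sumr_ge0 // => i _; exact: sqr_ge0.
rewrite psumr_eq0; last by move=> i _; exact: sqr_ge0.
by move=> /allP/(_ j (mem_index_enum j))/=; rewrite sqrf_eq0 => /eqP ->; rewrite mxE.
Qed.

End Euclidean.

Section Blocks.
Context {R : realType} (s : nat) (n_ : 'I_s -> nat).

Definition block_grad (i : 'I_s) (h : 'rV[R]_(\sum_i n_ i) -> R)
    (x : 'rV[R]_(\sum_i n_ i)) : 'rV[R]_(n_ i) :=
  submxrow (gradient h x) i.

Definition splice (i : 'I_s) (y x : 'rV[R]_(\sum_i n_ i)) :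
    'rV[R]_(\sum_i n_ i) :=
  \mxrow_j (if (j < i)%N then submxrow y j else submxrow x j).

End Blocks.

Section CondExp.
Context {R : realType} {d : measure_display} {T : measurableType d}
  (P : probability T R).

(* Y is a version of E[X | G] for a sub-sigma-algebra G. *)
Definition is_cond_exp (G : set (set T)) (X Y : T -> R) : Prop :=
  [/\ P.-integrable setT (EFin \o X),
      P.-integrable setT (EFin \o Y),
      (forall B : set R, measurable B -> G (Y @^-1` B)) &
      forall A, G A ->
        (\int[P]_(w in A) (Y w)%:E = \int[P]_(w in A) (X w)%:E)%E].

Definition is_cond_expv n (G : set (set T)) (X Y : T -> 'rV[R]_n) : Prop :=
  forall j, is_cond_exp G (fun w => X w 0 j) (fun w => Y w 0 j).

End CondExp.

(* Iterations are numbered from 0: the index k below stands for iteration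
   k + 1, so that x 0 is the starting point. *)
Section BSG.
Context {R : realType} {d d' : measure_display}
  {Omega : measurableType d} {S : measurableType d'} {P : probability Omega R}
  (s : nat) (n_ : 'I_s -> nat).
Local Notation vec := 'rV[R]_(\sum_i n_ i).
Variables (m : nat -> nat) (xis : forall k, 'I_(m k) -> {RV P >-> S}).

(* The sigma-algebra generated by the mini-batches drawn before iteration k. *)
Definition history (k : nat) : set (set Omega) :=
  <<s [set A | exists (j : nat) (l : 'I_(m j)) (B : set S),
         [/\ (j < k)%N, measurable B & A = xis l @^-1` B]] >>.

Variables (f : vec -> S -> R) (x : nat -> Omega -> vec).

Definition stoch_block_grad (i : 'I_s) (k : nat) (w : Omega) : 'rV[R]_(n_ i) :=
  (m k)%:R^-1 *:
  \sum_(l < m k) block_grad i (f^~ (xis l w)) (splice i (x k.+1 w) (x k w)).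

(* This determines x: [stoch_block_grad i k] only depends on x k and on the
   blocks of x k.+1 of index < i. *)
Definition is_bsg (x1 : vec) (alpha : 'I_s -> nat -> R) : Prop :=
  (forall w, x 0%N w = x1) /\
  forall k i w,
    is_argmin
      (prox_linear (stoch_block_grad i k w) (submxrow (x k w) i) (alpha i k))
      (submxrow (x k.+1 w) i).

Definition exact_block_grad (F : vec -> R) (i : 'I_s) (k : nat) (w : Omega) :
    'rV[R]_(n_ i) :=
  block_grad i F (splice i (x k.+1 w) (x k w)).

Definition grad_error (F : vec -> R) (i : 'I_s) (k : nat) (w : Omega) :
    'rV[R]_(n_ i) :=
  stoch_block_grad i k w - exact_block_grad F i k w.

End BSG.

(* Main.v *)
(* Compare each block update with the gradient step taken from the full iterate
   x^k: the partial gradients at the spliced points differ from those at x^k by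
   at most L ||x^{k+1} - x^k||, and E ||x^{k+1} - x^k||^2 = O(beta_k^2) because
   the iterates and the noise are bounded in L^2.  The descent lemma then gives
     E F(x^{k+1}) + c0 beta_k B_k <= E F(x^k) + O(beta_k^2),
   where B_k = E ||grad F(x^k)||^2; the noise contributes only O(beta_k^2) since
   grad F(x^k) is measurable for the history, so that delta_i^k may be replaced
   by its conditional expectation.  Hence sum_k beta_k B_k < oo.  Moreover
   |B_{k+1} - B_k| = O(beta_k), so the increments of B_k^2 are summable, B_k
   converges, and sum_k beta_k = oo forces the limit to be 0. *)
Require Import Defs.
From HB Require Import structures.
From mathcomp Require Import all_boot all_order all_algebra.
From mathcomp Require Import all_classical all_reals all_analysis.
From mathcomp Require Import finmap measurable_realfun ring lra.
Set Implicit Arguments.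
Unset Strict Implicit.
Unset Printing Implicit Defensive.
Import Order.TTheory GRing.Theory Num.Theory.
Import numFieldNormedType.Exports.
Local Open Scope classical_set_scope.
Local Open Scope ring_scope.

(** * Real sequences: weighted summability, slow variation and telescoped descent *)

Section Sequences.
Context {R : realType}.
Implicit Types (b B V : nat -> R).

Lemma is_cvg_series_nneseries (b : nat -> R) : (forall k, 0 <= b k) ->
  (\sum_(0 <= k <oo) (b k)%:E < +oo)%E -> cvgn (series b).
Proof.
move=> b0 bfin.
apply: nondecreasing_is_cvgn; first exact: nondecreasing_series.
have b0e : (0 <= \sum_(0 <= k <oo) (b k)%:E)%E.
  by apply: nneseries_ge0 => k _ _; rewrite lee_fin.
exists (fine (\sum_(0 <= k <oo) (b k)%:E)%E) => _ [n _ <-].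
rewrite -lee_fin fineK ?ge0_fin_numE// /series /= -sumEFin.
by apply: nneseries_lim_ge => k _ _; rewrite lee_fin.
Qed.

Lemma series_le_lim (b : nat -> R) n : (forall k, 0 <= b k) ->
  cvgn (series b) -> series b n <= limn (series b).
Proof.
move=> b0 cb; apply: nondecreasing_cvgn_le => //.
exact: nondecreasing_series.
Qed.

(** Since the series of [b] diverges, summability of [b k * B k] alone yields only that the lower
    limit of [B] is 0. The bound on the increments rules out oscillation. *)
Lemma cvgn0_of_weighted_summable b B (C : R) :
    (forall k, 0 < b k) -> (forall k, 0 <= B k) ->
    (\sum_(0 <= k <oo) (b k)%:E = +oo)%E -> cvgn (series (fun k => b k ^+ 2)) ->
    cvgn (series (fun k => b k * B k)) ->
    (forall k, `|B k.+1 - B k| <= C * b k) ->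
  B @ \oo --> 0.
Proof.
move=> b0 B0 bpinf b2 bB dB.
have C0 : 0 <= C.
  have := le_trans (normr_ge0 _) (dB 0%N).
  by rewrite pmulr_lge0.
(* The increments of [B ^+ 2] are summable, so [B] converges; a positive limit
   would make the series of [b] converge. *)
pose Q k := B k ^+ 2.
have cQ : cvgn Q.
  have : cvgn (series (telescope Q)).
    apply: normed_cvg.
    apply: (@series_le_cvg _ _ (fun k => 2 * C * (b k * B k) + C ^+ 2 * b k ^+ 2)).
    - by move=> k /=; exact: normr_ge0.
    - move=> k; have := b0 k; have := B0 k.
      by move=> Bk /ltW bk; rewrite addr_ge0 ?mulr_ge0 ?sqr_ge0.
    - move=> k /=; rewrite /telescope /Q /=.
      rewrite subr_sqr normrM.
      have := dB k; set D := `|_| => DC.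
      (* The product of this bound with [C * b k] is the general term of the dominating series. *)
      have B1 : `|B k.+1 + B k| <= 2 * B k + C * b k.
        rewrite ger0_norm ?addr_ge0//.
        have : B k.+1 - B k <= C * b k by apply: le_trans DC; exact: ler_norm.
        by lra.
      apply: (@le_trans _ _ ((C * b k) * (2 * B k + C * b k))).
        by apply: ler_pM => //; exact: normr_ge0.
      by rewrite le_eqVlt; apply/orP; left; apply/eqP; ring.
    - rewrite (_ : series _ = (2 * C) \*: series (fun k => b k * B k)
         \+ (C ^+ 2) \*: series (fun k => b k ^+ 2)).
        by apply: is_cvgD; apply: is_cvgZr.
      apply/funext => n /=; rewrite /series /=.
      by rewrite big_split /= -!mulr_sumr.
  rewrite telescopeK => cQ'.
  have -> : Q = (fun n => (Q n - Q 0%N) + Q 0%N) by apply/funext => n; rewrite subrK.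
  by apply: is_cvgD => //; exact: is_cvg_cst.
have cB : B @ \oo --> Num.sqrt (limn Q).
  have -> : B = Num.sqrt \o Q.
    by apply/funext => k /=; rewrite /Q sqrtr_sqr ger0_norm.
  by apply: continuous_cvg => //; exact: sqrt_continuous.
have [r0|] := ltP 0 (Num.sqrt (limn Q)); last first.
  by move=> r0; move: cB; rewrite (_ : Num.sqrt _ = 0)//; apply/le_anti; rewrite r0 sqrtr_ge0.
exfalso.
set r := Num.sqrt _ in cB r0.
have /cvgrPdist_lt /(_ (r / 2)) := cB.
case=> [|N _ HN]; first by rewrite divr_gt0.
have bB0 k : 0 <= b k * B k by rewrite mulr_ge0// ltW.
(* From [N] on, [B] is at least [r / 2], so [b k <= 2 / r * (b k * B k)]; the terms before [N] go
   into [series b N]. *)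
have sb n : series b n <=
    2 / r * series (fun k => b k * B k) n + series b N.
  have sbN : 0 <= series b N by apply: sumr_ge0 => k _; exact: ltW.
  have [nN|/ltnW Nn] := leqP n N.
    apply: (@le_trans _ _ (series b N)).
      by apply: nondecreasing_series => // k _ _; exact: ltW.
    rewrite lerDr mulr_ge0 ?divr_ge0 ?(ltW r0)//.
    by apply: sumr_ge0 => k _.
  rewrite -(subnK Nn) addnC; elim: (n - N)%N => [|j IH].
    rewrite addn0 lerDr mulr_ge0 ?divr_ge0 ?(ltW r0)//.
    by apply: sumr_ge0 => k _.
  have Bj : r / 2 <= B (N + j)%N.
    have := HN (N + j)%N (leq_addr _ _); rewrite ltr_distlC => /andP[+ _].
    by move/ltW; lra.
  rewrite addnS !seriesSr mulrDr addrAC lerD// mulrCA ler_peMr// ?(ltW (b0 _))//.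
  by rewrite mulrAC ler_pdivlMr// mul1r; move: Bj; lra.
have : (\sum_(0 <= k <oo) (b k)%:E <=
    (2 / r * limn (series (fun k => b k * B k)) + series b N)%:E)%E.
  apply: lime_le.
    by apply: is_cvg_nneseries => k _ _; rewrite lee_fin ltW.
  apply: nearW => n; rewrite sumEFin lee_fin.
  apply: le_trans (sb n) _; rewrite lerD2r ler_wpM2l ?divr_ge0 ?(ltW r0)//.
  exact: series_le_lim.
by rewrite bpinf leye_eq.
Qed.

(** Telescoping the descent inequality bounds [c] times the partial sums of [b k * B k] by
    [V 0 - lb] plus [C] times the sum of the [b k ^+ 2]. *)
Lemma descent_cvgn0 b B V (c C lb : R) :
    0 < c -> (forall k, 0 < b k) -> (forall k, 0 <= B k) -> (forall k, lb <= V k) ->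
    (\sum_(0 <= k <oo) (b k)%:E = +oo)%E ->
    (\sum_(0 <= k <oo) (b k ^+ 2)%:E < +oo)%E ->
    (forall k, V k.+1 + c * (b k * B k) <= V k + C * b k ^+ 2) ->
    (forall k, `|B k.+1 - B k| <= C * b k) ->
  B @ \oo --> 0.
Proof.
move=> c0 b0 B0 Vlb bpinf /is_cvg_series_nneseries b2 descent dB.
have {}b2 : cvgn (series (fun k => b k ^+ 2)) by apply: b2 => k; exact: sqr_ge0.
apply: (@cvgn0_of_weighted_summable b B C) => //.
have C0 : 0 <= C.
  by have := le_trans (normr_ge0 _) (dB 0%N); rewrite pmulr_lge0.
apply: nondecreasing_is_cvgn.
  by apply: nondecreasing_series => k _ _; rewrite mulr_ge0// ltW.
have sV n : V n + c * series (fun k => b k * B k) n <=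
            V 0%N + C * series (fun k => b k ^+ 2) n.
  elim: n => [|n IH]; first by rewrite /series /= !big_nil !mulr0.
  rewrite !seriesSr !mulrDr; have := descent n.
  move: IH; lra.
exists ((V 0%N + C * limn (series (fun k => b k ^+ 2)) - lb) / c) => _ [n _ <-].
rewrite ler_pdivlMr// mulrC.
have : C * series (fun k => b k ^+ 2) n <= C * limn (series (fun k => b k ^+ 2)).
  by rewrite ler_wpM2l// series_le_lim// => k; exact: sqr_ge0.
by have := sV n; have := Vlb n; lra.
Qed.

End Sequences.

(** * Euclidean norm, gradients and the descent lemma *)

Section Descent.
Context {R : realType} (n : nat).
Implicit Types (u v x y z : 'rV[R]_n) (F : 'rV[R]_n -> R).

Lemma enorm_ge0 v : 0 <= enorm v.
Proof. exact: sqrtr_ge0. Qed.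

Lemma sqr_enorm v : enorm v ^+ 2 = \sum_j v 0 j ^+ 2.
Proof. by rewrite sqr_sqrtr// sumr_ge0// => j _; exact: sqr_ge0. Qed.

Lemma coord_le_enorm v j : `|v 0 j| <= enorm v.
Proof.
rewrite -sqrtr_sqr ler_sqrt; last by rewrite sumr_ge0// => i _; exact: sqr_ge0.
by rewrite (bigD1 j)//= lerDl sumr_ge0// => i _; exact: sqr_ge0.
Qed.

Lemma enorm_le_coord u v : (forall j, `|u 0 j| <= `|v 0 j|) -> enorm u <= enorm v.
Proof.
move=> uv; rewrite ler_sqrt; last by rewrite sumr_ge0// => i _; exact: sqr_ge0.
apply: ler_sum => j _; rewrite -real_normK ?num_real//.
by rewrite -[leRHS]real_normK ?num_real// ler_sqr ?nnegrE.
Qed.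

Lemma enormZ (a : R) v : enorm (a *: v) = `|a| * enorm v.
Proof.
rewrite /enorm -sqrtr_sqr -sqrtrM ?sqr_ge0// mulr_sumr; congr Num.sqrt.
by apply: eq_bigr => j _; rewrite mxE exprMn.
Qed.

Lemma derive_dotv F z v : differentiable F z ->
  'D_v F z = dotv (gradient F z) v.
Proof.
move=> dF; rewrite deriveE//.
rewrite [v in LHS]row_sum_delta linear_sum /dotv; apply: eq_bigr => j _.
by rewrite linearZ /= mxE deriveE// mulrC.
Qed.

(** The difference quotient of the restriction to the line at [t] is the one that defines the
    directional derivative at [x + t *: v]. *)
Lemma is_derive_line F x v (t : R) : differentiable F (x + t *: v) ->
  is_derive t 1 (fun r : R => F (x + r *: v)) (dotv (gradient F (x + t *: v)) v).
Proof.
move=> dF; rewrite -derive_dotv//.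
have E : (fun h : R => h^-1 *: (F (x + (h *: (1:R) + t) *: v) - F (x + t *: v))) =
         (fun h : R => h^-1 *: (F (h *: v + (x + t *: v)) - F (x + t *: v))).
  apply/funext => h; congr (_ *: (F _ - _)).
  by rewrite [h *: _]mulr1 scalerDl addrCA.
have dv : derivable F (x + t *: v) v by exact: diff_derivable.
split.
  by rewrite /derivable /= E; exact: dv.
by rewrite /derive /= E.
Qed.

Lemma derive_MVT F x y : (forall z, differentiable F z) ->
  exists2 t : R, 0 < t < 1 &
    F y - F x = dotv (gradient F (x + t *: (y - x))) (y - x).
Proof.
move=> dF.
pose phi (r : R) := F (x + r *: (y - x)).
have dphi (t : R) : is_derive t 1 phi (dotv (gradient F (x + t *: (y - x))) (y - x)).
  exact: is_derive_line.
have [|t] := @MVT R phi _ 0 1 ltr01 (fun t _ => dphi t).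
  apply: continuous_subspaceT => t.
  by apply/differentiable_continuous/derivable1_diffP; have [] := dphi t.
rewrite in_itv /= => t01; rewrite /phi scale1r scale0r addr0 subrKC subr0 mulr1 => E.
by exists t.
Qed.

(** By the mean value theorem the remainder is the gradient difference between an intermediate point
    and [x], paired with [y - x]. Estimating it coordinate by coordinate gives the factor [n] in
    place of the sharp 1/2. *)
Lemma descent_lemma F x y (L : R) : (forall z, differentiable F z) -> 0 <= L ->
    (forall j y z, `|gradient F y 0 j - gradient F z 0 j| <= L * enorm (y - z)) ->
  `|F y - F x - dotv (gradient F x) (y - x)| <= n%:R * L * enorm (y - x) ^+ 2.
Proof.
move=> dF L0 Flip; have [t /andP[t0 t1] ->] := derive_MVT x y dF.
rewrite /dotv -sumrB; apply: le_trans (ler_norm_sum _ _ _) _.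
have : \sum_(j < n) L * enorm (y - x) ^+ 2 = n%:R * L * enorm (y - x) ^+ 2.
  by rewrite sumr_const card_ord -mulrA mulr_natl.
move=> <-; apply: ler_sum => j _.
rewrite -mulrBl normrM expr2 mulrA ler_pM// ?coord_le_enorm//.
apply: le_trans (Flip _ _ _) _; rewrite ler_wpM2l//.
rewrite addrAC subrr add0r enormZ gtr0_norm// ler_piMl ?enorm_ge0//.
exact: ltW.
Qed.

End Descent.

(** * Measurability of Caratheodory functions and of their partial derivatives *)

Section Caratheodory.
Context {R : realType} {d d' : measure_display} {T : measurableType d}
  {S : measurableType d'} (n : nat).
Implicit Types (f : 'rV[R]_n -> S -> R) (X : T -> 'rV[R]_n) (U : T -> S).

(* [X] is rounded down to the grid of mesh [1 / p.+1], where it takes countably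
   many values. *)
Let key X p w : 'rV[int]_n := \row_j Num.floor (X w 0 j * p.+1%:R).
Let grid p (v : 'rV[int]_n) : 'rV[R]_n := \row_j ((v 0 j)%:~R / p.+1%:R).

(** With [X] rounded, the composite is measurable because it is glued from countably many sections
    [f z \o U]. Continuity in the first argument passes this to the limit as the mesh tends to 0. *)
Lemma measurable_caratheodory f X U :
    (forall z, measurable_fun setT (f z)) -> (forall u, continuous (f^~ u)) ->
    (forall j, measurable_fun setT (fun w => X w 0 j)) -> measurable_fun setT U ->
  measurable_fun setT (fun w => f (X w) (U w)).
Proof.
move=> mf cf mX mU.
have mkey p v : measurable [set w | key X p w = v].
  rewrite (_ : [set w | _] = \bigcap_(j in [set: 'I_n])
     ((fun w => X w 0 j) @^-1` `[(v 0 j)%:~R / p.+1%:R, (v 0 j + 1)%:~R / p.+1%:R[)).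
    apply: fin_bigcap_measurable; first exact: finite_finset.
    by move=> j _; rewrite -[X in measurable X]setTI; exact: mX.
  apply/seteqP; split=> [w /= <- j _|w H].
    rewrite /= in_itv /= ler_pdivrMr// ltr_pdivlMr// mxE.
    exact: floor_itv.
  apply/rowP => j; rewrite mxE.
  apply: floor_def; have := H j I.
  by rewrite /= in_itv /= ler_pdivrMr// ltr_pdivlMr.
apply: (@measurable_fun_cvg _ _ _ setT (fun p w => f (grid p (key X p w)) (U w))).
  move=> p _ B mB; rewrite setTI.
  rewrite (_ : _ @^-1` B = \bigcup_v ([set w | key X p w = v] `&`
     ((f (grid p v) \o U) @^-1` B))); last first.
    apply/seteqP; split=> [w /= Bw|w [v _ [/= <-]]//].
    by exists (key X p w).
  apply: countable_bigcupT_measurable; first exact: countableP.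
  move=> v; apply: measurableI => //.
  rewrite -[X in measurable X]setTI.
  by apply: (measurableT_comp (mf _) mU).
move=> w _.
apply: (continuous_cvg _ (cf (U w) (X w))).
apply/cvgrPdist_le => e e0.
have /cvgrPdist_le/(_ e e0) := @cvg_harmonic R.
apply: filterS => p /=; rewrite sub0r normrN ger0_norm; last exact: harmonic_ge0.
(* The norm here is the sup norm, and rounding moves each coordinate by at most the mesh. *)
move=> pe; rewrite [leLHS]/Num.norm /= mx_normrE; apply/bigmax_leP; split; first exact: ltW.
move=> [i j] _ /=; rewrite {i}(ord1 i) !mxE.
apply: le_trans pe; rewrite /harmonic /=.
have /andP[k0 k1] := floor_itv (X w 0 j * p.+1%:R).
rewrite -[X in `|X - _|](@mulfK _ p.+1%:R)// -mulrBl normrM (ger0_norm (x := p.+1%:R^-1))//.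
rewrite ler_piMl// ger0_norm ?subr_ge0// lerBlDl ltW//.
by move: k1; rewrite intrD.
Qed.

(** The partial derivative is the pointwise limit of difference quotients with steps [harmonic p],
    each of which is measurable by the previous lemma. *)
Lemma measurable_gradient f X U j :
    (forall z, measurable_fun setT (f z)) ->
    (forall u z, differentiable (f^~ u) z) ->
    (forall j, measurable_fun setT (fun w => X w 0 j)) -> measurable_fun setT U ->
  measurable_fun setT (fun w => gradient (f^~ (U w)) (X w) 0 j).
Proof.
move=> mf df mX mU.
have cf u : continuous (f^~ u) by move=> z; exact/differentiable_continuous/df.
pose e : 'rV[R]_n := delta_mx 0 j.
apply: (@measurable_fun_cvg _ _ _ setT
    (fun p w => (harmonic p)^-1 * (f (harmonic p *: e + X w) (U w) - f (X w) (U w)))).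
  move=> p; apply: measurable_funM => //.
  apply: measurable_funB; last exact: measurable_caratheodory.
  apply: measurable_caratheodory => // i.
  under eq_fun do rewrite !mxE.
  exact: measurable_funD.
move=> w _; rewrite /gradient mxE.
have /cvgr_dnbhsP dv : derivable (f^~ (U w)) (X w) e by exact: diff_derivable.
apply: dv; split; last exact: cvg_harmonic.
by move=> p; rewrite gt_eqF// harmonic_gt0.
Qed.

End Caratheodory.

(** * Integrability and expectation of real random variables *)

Section Expectation.
Context {R : realType} {d : measure_display} {T : measurableType d}
  (P : probability T R).
Implicit Types X Y Z h : T -> R.
Local Notation Int X := (P.-integrable setT (EFin \o X)).

Lemma Int_measurable X : Int X -> measurable_fun setT X.
Proof. by move=> /measurable_int/measurable_EFinP. Qed.

Lemma Int_dominated X Y : measurable_fun setT X -> Int Y ->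
  (forall w, `|X w| <= Y w) -> Int X.
Proof.
move=> mX iY XY; apply: le_integrable iY => //; first exact/measurable_EFinP.
by move=> w _ /=; rewrite lee_fin (le_trans (XY w))// ler_norm.
Qed.

Lemma Int_cst (r : R) : Int (fun=> r).
Proof. exact: (finite_measure_integrable_cst P r measurableT). Qed.

Lemma IntD X Y : Int X -> Int Y -> Int (fun w => X w + Y w).
Proof. by move=> iX iY; exact: (integrableD measurableT iX iY). Qed.

Lemma IntB X Y : Int X -> Int Y -> Int (fun w => X w - Y w).
Proof. by move=> iX iY; exact: (integrableB measurableT iX iY). Qed.

Lemma IntZ (r : R) X : Int X -> Int (fun w => r * X w).
Proof. by move=> iX; exact: (integrableZl measurableT r iX). Qed.

Lemma Int_norm X : Int X -> Int (fun w => `|X w|).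
Proof.
move=> iX; have mX := Int_measurable iX.
apply: le_integrable iX => //; first exact/measurable_EFinP/measurableT_comp.
by move=> w _ /=; rewrite normr_id.
Qed.

Lemma Int_sum I (s : seq I) (X : I -> T -> R) : (forall i, Int (X i)) ->
  Int (fun w => \sum_(i <- s) X i w).
Proof.
move=> iX.
have -> : EFin \o (fun w => \sum_(i <- s) X i w) = (fun w => \sum_(i <- s) (X i w)%:E)%E.
  by apply/funext => w /=; rewrite sumEFin.
by apply: integrable_sum => // i _; exact: iX.
Qed.

Lemma Rintegral_sum I (s : seq I) (X : I -> T -> R) : (forall i, Int (X i)) ->
  \int[P]_w (\sum_(i <- s) X i w) = \sum_(i <- s) \int[P]_w X i w.
Proof.
move=> iX; rewrite /Rintegral.
under eq_integral do rewrite -sumEFin.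
rewrite (integral_sum measurableT iX) -sum_fine// => i _.
exact: integrable_fin_num.
Qed.

Lemma Rintegral_probability_cst (r : R) : \int[P]_(_ in setT) r = r.
Proof. by rewrite (Rintegral_cst P measurableT) -[X in fine X]/(P setT) probability_setT mulr1. Qed.

Lemma expectation_Rintegral X : Int X -> 'E_P[X]%E = (\int[P]_w X w)%:E.
Proof. by move=> iX; rewrite unlock fineK//; exact: integrable_fin_num. Qed.

Lemma expectation_fin_Int X (r : R) : measurable_fun setT X ->
  (forall w, 0 <= X w) -> ('E_P[X] <= r%:E)%E -> Int X.
Proof.
move=> mX X0 EX; apply/integrableP; split; first exact/measurable_EFinP.
under eq_integral do rewrite /= ger0_norm//.
by apply: le_lt_trans (ltry r); rewrite unlock in EX.
Qed.

End Expectation.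

(** * Conditional expectation: pulling out a factor measurable for [<<s G>>] *)

Section PullOut.
Import HBNNSimple.
Context {R : realType} {d : measure_display} {T : measurableType d}
  (P : probability T R) (G : set (set T)).
Hypothesis G_measurable : forall A, G A -> measurable A.
Implicit Types X Y Z h : T -> R.
Local Notation Int X := (P.-integrable setT (EFin \o X)).
Local Notation TG := (g_sigma_algebraType G).

Lemma g_sigma_measurable (A : set T) : <<s G >> A -> measurable A.
Proof.
apply: smallest_sub => //; split.
- exact: measurable0.
- by move=> B mB; rewrite setTD; exact: measurableC.
- by move=> B mB; exact: bigcupT_measurable.
Qed.

Lemma g_sigma_measurable_fun d' (S : measurableType d') (h : T -> S) :
  measurable_fun [set: TG] (h : TG -> S) -> measurable_fun [set: T] h.
Proof. by move=> mh _ B mB; apply: g_sigma_measurable; exact: mh. Qed.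

(** A simple function is a finite combination of indicators of its level sets; these lie in
    [<<s G>>], where [Z] integrates to 0. *)
Lemma Rintegral_mul_nnsfun Z (g : {nnsfun TG >-> R}) :
    Int Z -> (forall A, <<s G >> A -> \int[P]_(w in A) Z w = 0) ->
  \int[P]_w ((g : T -> R) w * Z w) = 0.
Proof.
move=> iZ Z0.
have mA y : <<s G >> ((g : TG -> R) @^-1` [set y]).
  by have := measurable_sfunP g (measurable_set1 y).
have E w : (g : T -> R) w * Z w =
    \sum_(y <- fset_set ((g : TG -> R) @` setT))
       y * (Z \_ ((g : TG -> R) @^-1` [set y])) w.
  rewrite fimfunE fsbig_finite//= mulr_suml; apply: eq_bigr => y _.
  rewrite -mulrA; congr (_ * _); rewrite indicE patchE.
  by case: ifP => _; rewrite ?mul1r ?mul0r.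
have iA y : Int (Z \_ ((g : TG -> R) @^-1` [set y])).
  rewrite -restrict_EFin -integrable_mkcond; last exact: g_sigma_measurable.
  by apply: integrableS iZ => //; exact: g_sigma_measurable.
under eq_Rintegral do rewrite E.
rewrite Rintegral_sum; last by move=> i; exact: IntZ.
rewrite big1// => y _; rewrite RintegralZl//.
by rewrite -Rintegral_mkcond Z0 ?mulr0.
Qed.

(** Simple functions increasing to [h] reduce this to the previous lemma by dominated convergence.
    The dominating function is the absolute value of [h * Z], so [h] may be unbounded. *)
Lemma Rintegral_mul_ge0 Z h :
    Int Z -> (forall A, <<s G >> A -> \int[P]_(w in A) Z w = 0) ->
    measurable_fun [set: TG] (h : TG -> R) -> (forall w, 0 <= h w) ->
    Int (fun w => h w * Z w) ->
  \int[P]_w (h w * Z w) = 0.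
Proof.
move=> iZ Z0 mh h0 ihZ.
have mhe : measurable_fun [set: TG] (EFin \o h : TG -> \bar R) by exact/measurable_EFinP.
pose g := nnsfun_approx measurableT mhe.
have cg w : (g n w)%:E @[n --> \oo] --> (h w)%:E.
  by apply: cvg_nnsfun_approx => // v _; rewrite /= lee_fin.
have cgR w : g n w @[n --> \oo] --> h w.
  exact: (fine_cvg (cg w)).
have gh n w : g n w <= h w.
  rewrite -(cvg_lim _ (cgR w))//; apply: (nondecreasing_cvgn_le (u_ := g ^~ w)).
    by move=> i j ij; have /lefP := nd_nnsfun_approx measurableT mhe ij; exact.
  by apply/cvg_ex; exists (h w); exact: cgR.
have mZ := Int_measurable iZ.
have mg n : measurable_fun [set: T] (g n : T -> R).
  by apply: g_sigma_measurable_fun; exact: measurable_funPT.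
have [|||||_ _ int_cvg] := @dominated_convergence _ _ _ P setT measurableT
    (fun n w => ((g n : T -> R) w * Z w)%:E) (fun w => (h w * Z w)%:E)
    (fun w => `|h w * Z w|%:E).
- by move=> n; apply/measurable_EFinP; exact: measurable_funM.
- exact: measurable_int ihZ.
- apply: aeW => w _; apply: cvg_EFin; first exact: nearW.
  by apply: cvgMl; exact: cgR.
- exact: Int_norm.
- apply: aeW => w n _; rewrite lee_fin !normrM ler_wpM2r//.
  by rewrite !ger0_norm.
have int0 n : (\int[P]_w ((g n : T -> R) w * Z w)%:E = 0)%E.
  rewrite -[LHS]fineK; first by congr EFin; exact: Rintegral_mul_nnsfun.
  apply: integrable_fin_num => //; apply: Int_dominated (Int_norm ihZ) _.
    exact: measurable_funM.
  by move=> w; rewrite !normrM ler_wpM2r// !ger0_norm.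
rewrite /Rintegral -(cvg_lim _ int_cvg)//.
rewrite (_ : [sequence _]_n = cst 0%E) ?lim_cst//.
by apply/funext => n /=; exact: int0.
Qed.

(** [Z = X - Y] integrates to 0 over every set of [<<s G>>], so the nonnegative case applies to the
    positive and negative parts of [h]. *)
Lemma Rintegral_pull_out X Y h : is_cond_exp P <<s G>> X Y ->
    measurable_fun [set: TG] (h : TG -> R) ->
    Int (fun w => h w * X w) -> Int (fun w => h w * Y w) ->
  \int[P]_w (h w * X w) = \int[P]_w (h w * Y w).
Proof.
move=> [iX iY _ XY] mh ihX ihY.
pose Z w := X w - Y w.
have iZ : Int Z by exact: IntB.
have Z0 A : <<s G >> A -> \int[P]_(w in A) Z w = 0.
  move=> GA; rewrite RintegralB.
  - by rewrite /Rintegral XY// subrr.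
  - exact: g_sigma_measurable.
  - by apply: integrableS iX => //; exact: g_sigma_measurable.
  - by apply: integrableS iY => //; exact: g_sigma_measurable.
have mhT : measurable_fun [set: T] h by exact: g_sigma_measurable_fun.
have ihZ : Int (fun w => h w * Z w).
  by under eq_fun do rewrite mulrBr; exact: IntB.
(* Both parts of [h] lie between 0 and its absolute value, which makes their products with [Z]
   integrable. *)
have part (p : T -> R) : measurable_fun [set: TG] (p : TG -> R) ->
    (forall w, 0 <= p w <= `|h w|) ->
    Int (fun w => p w * Z w) /\ \int[P]_w (p w * Z w) = 0.
  move=> mp ph; have iZp : Int (fun w => p w * Z w).
    apply: Int_dominated (Int_norm ihZ) _.
      apply: measurable_funM; last exact: Int_measurable iZ.
      exact: g_sigma_measurable_fun.
    by move=> w; have /andP[p0 pw] := ph w; rewrite !normrM ler_wpM2r// ger0_norm.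
  split=> //; apply: Rintegral_mul_ge0 => // w.
  by case/andP: (ph w).
have [ip p0] : Int (fun w => Num.max (h w) 0 * Z w) /\
    \int[P]_w (Num.max (h w) 0 * Z w) = 0.
  apply: part; first exact: measurable_maxr.
  by move=> w; rewrite le_max lexx orbT ge_max ler_norm normr_ge0.
have [im m0] : Int (fun w => Num.max (- h w) 0 * Z w) /\
    \int[P]_w (Num.max (- h w) 0 * Z w) = 0.
  apply: part; first by apply: measurable_maxr => //; exact: measurable_funN.
  by move=> w; rewrite le_max lexx orbT ge_max -normrN ler_norm normr_ge0.
apply/eqP; rewrite -subr_eq0 -RintegralB//; apply/eqP.
transitivity (\int[P]_w (Num.max (h w) 0 * Z w - Num.max (- h w) 0 * Z w)).
  apply: eq_Rintegral => w _; rewrite -mulrBr -mulrBl; congr (_ * _).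
  have [h0|h0] := lerP 0 (h w); last first.
    by rewrite max_l ?sub0r ?opprK// oppr_ge0 ltW.
  by rewrite max_r ?subr0// oppr_le0.
by rewrite RintegralB// p0 m0 subrr.
Qed.

End PullOut.

(** * One deterministic step from [x] to [y]: coordinate [j] follows the partial gradient at [sp j]
    plus the noise [delta j] *)

Section Step.
Context {R : realType} (n : nat).
Variables (F : 'rV[R]_n -> R) (L c0 c1 : R).
Hypothesis F_diff : forall z, differentiable F z.
Hypothesis L_ge0 : 0 <= L.
Hypothesis F_lip : forall j y z,
  `|gradient F y 0 j - gradient F z 0 j| <= L * enorm (y - z).
Hypotheses (c0_ge0 : 0 <= c0) (c1_ge0 : 0 <= c1).
Local Notation grad := (gradient F).

Lemma sumr_const_ord (r : R) : \sum_(i < n) r = n%:R * r.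
Proof. by rewrite sumr_const card_ord mulr_natl. Qed.

(* The factors appearing in [grad_growth], [step_move], [step_descent] and
   [step_variation] respectively. *)
Definition growth : R := 2 * enorm (grad 0) ^+ 2 + 2 * L ^+ 2.
Definition move_const : R := n%:R * c1 ^+ 2 * (12 * growth + 2).
Definition descent_const : R :=
  n%:R * (c1 * L * (growth + move_const)) + n%:R * L * move_const.
Definition var_const : R := n%:R * (L * (growth + move_const)).

Lemma growth_ge0 : 0 <= growth.
Proof. by rewrite addr_ge0// mulr_ge0// sqr_ge0. Qed.

Lemma move_const_ge0 : 0 <= move_const.
Proof. by rewrite !mulr_ge0 ?sqr_ge0// addr_ge0// mulr_ge0// growth_ge0. Qed.

Lemma descent_const_ge0 : 0 <= descent_const.
Proof.
rewrite /descent_const; move: move_const move_const_ge0 => K K0.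
by rewrite addr_ge0// !mulr_ge0// addr_ge0// growth_ge0.
Qed.

Lemma var_const_ge0 : 0 <= var_const.
Proof.
rewrite /var_const; move: move_const move_const_ge0 => K K0.
by rewrite !mulr_ge0// addr_ge0// growth_ge0.
Qed.

Lemma sqr_coord_le_enorm (v : 'rV[R]_n) j : v 0 j ^+ 2 <= enorm v ^+ 2.
Proof.
rewrite -[leLHS]real_normK ?num_real// ler_sqr ?nnegrE ?enorm_ge0//.
exact: coord_le_enorm.
Qed.

Lemma grad_growth z j : grad z 0 j ^+ 2 <= growth * (1 + enorm z ^+ 2).
Proof.
have := F_lip j z 0; rewrite subr0; have := sqr_coord_le_enorm (grad 0) j.
set g := grad z 0 j; set g0 := grad 0 0 j; set e := enorm z => g0e gL.
have : (g - g0) ^+ 2 <= (L * e) ^+ 2.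
  rewrite -[leLHS]real_normK ?num_real// ler_sqr ?nnegrE//.
  by rewrite mulr_ge0// enorm_ge0.
rewrite /growth exprMn; set N := enorm _ ^+ 2 in g0e *.
have : 0 <= N * e ^+ 2 by rewrite mulr_ge0// sqr_ge0.
have : 0 <= L ^+ 2 by exact: sqr_ge0.
(* This square is the gap in [g ^+ 2 <= 2 * (g - g0) ^+ 2 + 2 * g0 ^+ 2]. *)
have : 0 <= (g - 2 * g0) ^+ 2 by exact: sqr_ge0.
nra.
Qed.

Variables (x y : 'rV[R]_n) (sp : 'I_n -> 'rV[R]_n) (a delta : 'I_n -> R) (b : R).
Hypothesis b_gt0 : 0 < b.
Hypothesis a_bounds : forall j, c0 * b <= a j <= c1 * b.
Hypothesis sp_between : forall i j, `|sp i 0 j - x 0 j| <= `|y 0 j - x 0 j|.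
Hypothesis y_step : forall j,
  y 0 j = x 0 j - a j * (grad (sp j) 0 j + delta j).

(** Every error of the step is a constant times [b * W] or [b ^+ 2 * W], and second moments bound
    the expectation of [W]. The norm of [y] is included because the points [sp j] may contain
    coordinates of [y]. *)
Definition step_weight : R :=
  1 + enorm x ^+ 2 + enorm y ^+ 2 + \sum_j delta j ^+ 2.
Local Notation W := step_weight.

Let sum_delta_ge0 : 0 <= \sum_j delta j ^+ 2.
Proof. by apply: sumr_ge0 => j _; exact: sqr_ge0. Qed.

Let delta_le j : delta j ^+ 2 <= \sum_j delta j ^+ 2.
Proof. by rewrite (bigD1 j)//= lerDl sumr_ge0// => i _; exact: sqr_ge0. Qed.

Lemma step_weight_ge0 : 0 <= W.
Proof. by rewrite !addr_ge0// sqr_ge0. Qed.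

Let gradx j : grad x 0 j ^+ 2 <= growth * W.
Proof.
apply: le_trans (grad_growth x j) _; rewrite ler_wpM2l ?growth_ge0//.
by rewrite /W -addrA lerDl addr_ge0// sqr_ge0.
Qed.

Let grady j : grad y 0 j ^+ 2 <= growth * W.
Proof.
apply: le_trans (grad_growth y j) _; rewrite ler_wpM2l ?growth_ge0//.
by rewrite /W -!addrA lerD2l addrCA lerDl addr_ge0// sqr_ge0.
Qed.

Lemma sqr_enorm_splice i : enorm (sp i) ^+ 2 <= 6 * (enorm x ^+ 2 + enorm y ^+ 2).
Proof.
rewrite !sqr_enorm -big_split mulr_sumr; apply: ler_sum => j _ /=.
have := sp_between i j; set u := x 0 j; set v := y 0 j; set s := sp i 0 j => suv.
have : (s - u) ^+ 2 <= (v - u) ^+ 2.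
  by rewrite -[leLHS]real_normK ?num_real// -[leRHS]real_normK ?num_real// ler_sqr ?nnegrE.
(* The two squares give [s ^+ 2 <= 2 * (v - u) ^+ 2 + 2 * u ^+ 2] and
   [(v - u) ^+ 2 <= 2 * u ^+ 2 + 2 * v ^+ 2]; together they produce the factor 6. *)
have : 0 <= (s - 2 * u) ^+ 2 by exact: sqr_ge0.
have : 0 <= (u + v) ^+ 2 by exact: sqr_ge0.
nra.
Qed.

Lemma step_move : enorm (y - x) ^+ 2 <= move_const * (b ^+ 2 * W).
Proof.
rewrite sqr_enorm.
have -> : move_const * (b ^+ 2 * W) =
    \sum_(j < n) (c1 ^+ 2 * (12 * growth + 2)) * (b ^+ 2 * W).
  by rewrite sumr_const_ord /move_const !mulrA.
apply: ler_sum => j _; rewrite !mxE y_step addrAC subrr add0r sqrrN exprMn.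
have /andP[a1 a2] := a_bounds j.
have a0 : 0 <= a j by apply: le_trans a1; rewrite mulr_ge0// ltW.
have aa : a j ^+ 2 <= c1 ^+ 2 * b ^+ 2.
  by rewrite -exprMn ler_sqr ?nnegrE// mulr_ge0// ltW.
(* Bound the square by [2 * g ^+ 2 + 2 * d ^+ 2]. The growth of the gradient and the factor 6 of
   [sqr_enorm_splice] give [12 * growth], and the noise gives 2. *)
have gd : (grad (sp j) 0 j + delta j) ^+ 2 <= (12 * growth + 2) * W.
  have := grad_growth (sp j) j; have := sqr_enorm_splice j.
  have := delta_le j; have := growth_ge0; rewrite /W.
  have := sum_delta_ge0; have := sqr_ge0 (enorm x); have := sqr_ge0 (enorm y).
  set g := grad _ _ _; set d := delta j; set D := \sum_j _.
  set X := enorm x ^+ 2; set Y := enorm y ^+ 2; set S := enorm (sp j) ^+ 2.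
  move=> Y0 X0 D0 M0 dD SXY gS.
  have : growth * S <= growth * (6 * (X + Y)) by rewrite ler_wpM2l.
  have : 0 <= growth * D by rewrite mulr_ge0.
  have : 0 <= (g - d) ^+ 2 by exact: sqr_ge0.
  nra.
have -> : c1 ^+ 2 * (12 * growth + 2) * (b ^+ 2 * W) =
  c1 ^+ 2 * b ^+ 2 * ((12 * growth + 2) * W) by ring.
by rewrite ler_pM// sqr_ge0.
Qed.

(* AM-GM: [2 e t <= e ^+ 2 / b + b * t ^+ 2] with [e = enorm (y - x) = O(b)]. *)
Let move2 t : t ^+ 2 <= growth * W ->
  2 * (enorm (y - x) * `|t|) <= (growth + move_const) * (b * W).
Proof.
move=> tW; have := step_move; set e := enorm (y - x) => eW.
have H : 0 <= (e - b * `|t|) ^+ 2 by exact: sqr_ge0.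
have bt : b ^+ 2 * `|t| ^+ 2 <= b ^+ 2 * (growth * W).
  by rewrite real_normK ?num_real// ler_wpM2l// sqr_ge0.
by rewrite -(ler_pM2l b_gt0); nra.
Qed.

(** Factor each difference of squares: the difference of the partial derivatives is at most
    [L * enorm (y - x)], and [move2] bounds the product of that distance with either derivative by a
    multiple of [b * W]. *)
Lemma step_variation :
  `|enorm (grad y) ^+ 2 - enorm (grad x) ^+ 2| <= var_const * (b * W).
Proof.
rewrite !sqr_enorm -sumrB; apply: le_trans (ler_norm_sum _ _ _) _.
have -> : var_const * (b * W) =
    \sum_(j < n) L * ((growth + move_const) * (b * W)).
  by rewrite sumr_const_ord /var_const !mulrA.
apply: ler_sum => j _; rewrite subr_sqr normrM.
have := move2 (gradx j); have := move2 (grady j).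
have := F_lip j y x; have := ler_normD (grad y 0 j) (grad x 0 j).
set gy := grad y 0 j; set gx := grad x 0 j; set e := enorm (y - x).
move=> gg ge m1 m2.
apply: (@le_trans _ _ (L * e * (`|gy| + `|gx|))); first by rewrite ler_pM.
rewrite -mulrA ler_wpM2l//; lra.
Qed.

(** In the first-order term, moving the gradient from [sp j] to [x] costs a multiple of
    [b ^+ 2 * W], the same order as the remainder of the descent lemma. The noise term keeps its
    sign, since only its average is of second order. *)
Lemma step_descent :
  F y + c0 * (b * enorm (grad x) ^+ 2) <=
  F x - \sum_j a j * (grad x 0 j * delta j) + descent_const * (b ^+ 2 * W).
Proof.
have := ler_norm (F y - F x - dotv (grad x) (y - x)).
move=> /le_trans/(_ (descent_lemma x y F_diff L_ge0 F_lip)).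
have : n%:R * L * enorm (y - x) ^+ 2 <= n%:R * L * (move_const * (b ^+ 2 * W)).
  by rewrite ler_wpM2l ?mulr_ge0// step_move.
have : dotv (grad x) (y - x) + c0 * (b * enorm (grad x) ^+ 2)
    + \sum_j a j * (grad x 0 j * delta j) <=
    n%:R * (c1 * L * (growth + move_const)) * (b ^+ 2 * W).
  have -> : n%:R * (c1 * L * (growth + move_const)) * (b ^+ 2 * W) =
      \sum_(j < n) (c1 * L * (growth + move_const)) * (b ^+ 2 * W).
    by rewrite sumr_const_ord !mulrA.
  rewrite sqr_enorm !mulr_sumr /dotv -!big_split /=; apply: ler_sum => j _.
  have -> : (y - x) 0 j = y 0 j - x 0 j by rewrite !mxE.
  rewrite y_step.
  have /andP[a1 a2] := a_bounds j.
  have a0 : 0 <= a j by apply: le_trans a1; rewrite mulr_ge0// ltW.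
  have := move2 (gradx j); have := F_lip j (sp j) x.
  have spe : enorm (sp j - x) <= enorm (y - x).
    by apply: enorm_le_coord => i; rewrite !mxE.
  have := enorm_ge0 (y - x).
  move: spe; set h := grad x 0 j; set g := grad (sp j) 0 j.
  set e := enorm (y - x); set es := enorm (sp j - x); set d := delta j.
  move=> ese e0 ge m.
  (* The first term on the right is nonpositive because [c0 * b <= a j]; the second isolates the
     change of gradient between [x] and [sp j]. *)
  have -> : h * (x 0 j - a j * (g + d) - x 0 j) + c0 * (b * h ^+ 2) + a j * (h * d)
    = - (a j - c0 * b) * h ^+ 2 + a j * (h * (h - g)) by ring.
  have : 0 <= (a j - c0 * b) * h ^+ 2 by rewrite mulr_ge0 ?sqr_ge0// subr_ge0.
  have : a j * (h * (h - g)) <= (c1 * b) * (`|h| * (L * e)).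
    apply: le_trans (ler_norm _) _; rewrite !normrM (ger0_norm a0).
    apply: ler_pM => //.
    apply: ler_wpM2l => //; rewrite distrC; apply: le_trans ge _.
    by rewrite ler_wpM2l.
  have : (c1 * b * L) * (2 * (e * `|h|)) <=
      (c1 * b * L) * ((growth + move_const) * (b * W)).
    by rewrite ler_wpM2l// !mulr_ge0// ltW.
  have : 0 <= c1 * b * L * (e * `|h|) by rewrite !mulr_ge0// ltW.
  nra.
rewrite /descent_const; lra.
Qed.

End Step.

(** * Expected descent along the random iterates, coordinate by coordinate *)

Section StochasticDescent.
Context {R : realType} {d : measure_display} {T : measurableType d}
  (P : probability T R) (n : nat).
Variables (F : 'rV[R]_n -> R) (L c0 c1 lb : R).
Hypothesis F_diff : forall z, differentiable F z.
Hypothesis F_C1 : continuous (gradient F).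
Hypothesis L_ge0 : 0 <= L.
Hypothesis F_lip : forall j y z,
  `|gradient F y 0 j - gradient F z 0 j| <= L * enorm (y - z).
Hypothesis F_lbound : forall z, lb <= F z.
Hypotheses (c0_gt0 : 0 < c0) (c1_ge0 : 0 <= c1).
Local Notation grad := (gradient F).
Local Notation Int X := (P.-integrable setT (EFin \o X)).

Lemma continuous_gradient_coord j : continuous (fun z => grad z 0 j).
Proof.
move=> z; apply: (@continuous_comp _ _ _ grad (fun v : 'rV[R]_n => v 0 j)).
  exact: F_C1.
exact: coord_continuous.
Qed.

(** The source is an arbitrary measurable type, so that the lemma also applies to [Omega] with the
    sigma-algebra of the history. *)
Lemma measurable_continuous_vec d' (S : measurableType d') (h : 'rV[R]_n -> R)
    (X : S -> 'rV[R]_n) :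
  continuous h -> (forall j, measurable_fun setT (fun w => X w 0 j)) ->
  measurable_fun setT (fun w => h (X w)).
Proof.
move=> ch mX.
exact: (@measurable_caratheodory _ _ _ S S n (fun z _ => h z) X id).
Qed.

(** The descent lemma at 0 gives quadratic growth, so the second moment of [x k] makes [F (x k)]
    integrable. *)
Lemma abs_quadratic_growth z :
  `|F z| <= `|F 0| + enorm (grad 0) ^+ 2 + (1 + n%:R * L) * enorm z ^+ 2.
Proof.
have := descent_lemma 0 z F_diff L_ge0 F_lip; rewrite subr0.
have : `|dotv (grad 0) z| <= enorm (grad 0) ^+ 2 + enorm z ^+ 2.
  rewrite !sqr_enorm -big_split /=; apply: le_trans (ler_norm_sum _ _ _) _.
  apply: ler_sum => j _; rewrite ler_norml; apply/andP; split.
    by have := sqr_ge0 (grad 0 0 j + z 0 j); have := sqr_ge0 (grad 0 0 j);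
       have := sqr_ge0 (z 0 j); nra.
  by have := sqr_ge0 (grad 0 0 j - z 0 j); have := sqr_ge0 (grad 0 0 j);
     have := sqr_ge0 (z 0 j); nra.
move=> h1 h2.
have -> : F z = (F z - F 0 - dotv (grad 0) z) + F 0 + dotv (grad 0) z by ring.
have := ler_normD (F z - F 0 - dotv (grad 0) z + F 0) (dotv (grad 0) z).
have := ler_normD (F z - F 0 - dotv (grad 0) z) (F 0).
lra.
Qed.

Variables (x : nat -> T -> 'rV[R]_n) (sp : 'I_n -> nat -> T -> 'rV[R]_n).
Variables (a : 'I_n -> nat -> R) (delta : 'I_n -> nat -> T -> R) (beta : nat -> R).
Variables (rho2 sigma2 Cb : R).
Hypothesis beta_gt0 : forall k, 0 < beta k.
Hypothesis a_bounds : forall j k, c0 * beta k <= a j k <= c1 * beta k.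
Hypothesis sp_between : forall i j k w,
  `|sp i k w 0 j - x k w 0 j| <= `|x k.+1 w 0 j - x k w 0 j|.
Hypothesis x_step : forall j k w, x k.+1 w 0 j =
  x k w 0 j - a j k * (grad (sp j k w) 0 j + delta j k w).
Hypothesis x_meas : forall k j, measurable_fun setT (fun w => x k w 0 j).
Hypothesis delta_meas : forall j k, measurable_fun setT (delta j k).
Hypothesis x_int : forall k, Int (fun w => enorm (x k w) ^+ 2).
Hypothesis x_bound : forall k, \int[P]_w (enorm (x k w) ^+ 2) <= rho2.
Hypothesis delta_int : forall j k, Int (fun w => delta j k w ^+ 2).
Hypothesis delta_bound : forall j k, \int[P]_w (delta j k w ^+ 2) <= sigma2.
Hypothesis bias : forall j k,
  `|\int[P]_w (grad (x k w) 0 j * delta j k w)| <= Cb * beta k.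

Let W k w := step_weight (x k w) (x k.+1 w) (fun j => delta j k w).

Let Cw : R := 1 + rho2 + rho2 + n%:R * sigma2.

Let W_int k : Int (W k).
Proof.
rewrite /W /step_weight; apply: IntD; last exact: Int_sum.
by apply: IntD => //; apply: IntD => //; exact: Int_cst.
Qed.

Let W_bound k : \int[P]_w W k w <= Cw.
Proof.
rewrite /W /step_weight.
have i1 := Int_cst P (1 : R).
have i2 := IntD i1 (x_int k).
have i3 := IntD i2 (x_int k.+1).
rewrite RintegralD//; last exact: Int_sum.
rewrite RintegralD// RintegralD// Rintegral_probability_cst Rintegral_sum//.
rewrite /Cw lerD//; first by rewrite lerD// lerD.
by rewrite -sumr_const_ord; exact: ler_sum.
Qed.

Lemma Int_F k : Int (fun w => F (x k w)).
Proof.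
apply: (Int_dominated (Y := fun w =>
   `|F 0| + enorm (grad 0) ^+ 2 + (1 + n%:R * L) * enorm (x k w) ^+ 2)).
- by apply: measurable_continuous_vec => // z; exact/differentiable_continuous.
- by apply: IntD; [exact: Int_cst|exact: IntZ].
- by move=> w; exact: abs_quadratic_growth.
Qed.

Lemma measurable_grad k j : measurable_fun setT (fun w => grad (x k w) 0 j).
Proof.
by apply: (@measurable_continuous_vec _ T (fun z => grad z 0 j)) => //;
  exact: continuous_gradient_coord.
Qed.

Lemma Int_sqr_grad_coord k j : Int (fun w => grad (x k w) 0 j ^+ 2).
Proof.
apply: (Int_dominated (Y := fun w => growth F L * (1 + enorm (x k w) ^+ 2))).
- by apply: measurable_funX; exact: measurable_grad.
- by apply: IntZ; apply: IntD => //; exact: Int_cst.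
- by move=> w; rewrite ger0_norm ?sqr_ge0//; exact: grad_growth.
Qed.

Lemma Int_sqr_grad k : Int (fun w => enorm (grad (x k w)) ^+ 2).
Proof.
by under eq_fun do rewrite sqr_enorm; apply: Int_sum => j; exact: Int_sqr_grad_coord.
Qed.

Lemma Int_grad_delta k j : Int (fun w => grad (x k w) 0 j * delta j k w).
Proof.
apply: (Int_dominated (Y := fun w => grad (x k w) 0 j ^+ 2 + delta j k w ^+ 2)).
- by apply: measurable_funM => //; exact: measurable_grad.
- by apply: IntD => //; exact: Int_sqr_grad_coord.
- move=> w; set g := grad _ _ _; set e := delta _ _ _; rewrite ler_norml.
  have := sqr_ge0 (g + e); have := sqr_ge0 (g - e).
  have := sqr_ge0 g; have := sqr_ge0 e => *.
  by apply/andP; split; nra.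
Qed.

(** Integrate [step_descent] and [step_variation], then apply [descent_cvgn0] with the expectation
    of [F (x k)] as the potential. *)
Lemma stochastic_descent_cvg0 :
    (\sum_(0 <= k <oo) (beta k)%:E = +oo)%E ->
    (\sum_(0 <= k <oo) (beta k ^+ 2)%:E < +oo)%E ->
  (fun k => \int[P]_w (enorm (grad (x k w)) ^+ 2)) @ \oo --> 0.
Proof.
move=> beta_sum beta2_sum.
have c0_ge0 : 0 <= c0 by exact: ltW.
have D0 : 0 <= descent_const F L c1 by exact: descent_const_ge0.
have V0 : 0 <= var_const F L c1 by exact: var_const_ge0.
have Cw0 : 0 <= Cw.
  by apply: le_trans (W_bound 0); apply: Rintegral_ge0 => w _; exact: step_weight_ge0.
(* A single constant must serve both the descent error and the increments, hence the sum. The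
   absolute value is there because the sign of [Cb] is not known. *)
pose C := (descent_const F L c1 + var_const F L c1) * Cw + n%:R * (c1 * `|Cb|).
apply: (@descent_cvgn0 R beta _ (fun k => \int[P]_w F (x k w)) c0 C lb) => //.
- by move=> k; apply: Rintegral_ge0 => w _; exact: sqr_ge0.
- move=> k; rewrite -(Rintegral_probability_cst P lb).
  by apply: le_Rintegral => //; [exact: Int_cst|exact: Int_F].
- move=> k.
  have iS : Int (fun w => \sum_j a j k * (grad (x k w) 0 j * delta j k w)).
    by apply: Int_sum => j; apply: IntZ; exact: Int_grad_delta.
  have iG : Int (fun w => c0 * (beta k * enorm (grad (x k w)) ^+ 2)).
    by apply: IntZ; apply: IntZ; exact: Int_sqr_grad.
  have iW : Int (fun w => descent_const F L c1 * (beta k ^+ 2 * W k w)).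
    by apply: IntZ; exact: IntZ.
  have iFS : Int (fun w => F (x k w) -
      \sum_j a j k * (grad (x k w) 0 j * delta j k w)).
    by apply: IntB => //; exact: Int_F.
  have : \int[P]_w (F (x k.+1 w) + c0 * (beta k * enorm (grad (x k w)) ^+ 2)) <=
     \int[P]_w (F (x k w) - \sum_j a j k * (grad (x k w) 0 j * delta j k w)
        + descent_const F L c1 * (beta k ^+ 2 * W k w)).
    apply: le_Rintegral => //.
    + by apply: IntD => //; exact: Int_F.
    + exact: IntD.
    + move=> w _; apply: (@step_descent _ _ _ _ _ _ F_diff L_ge0 F_lip c0_ge0 c1_ge0
        _ _ (fun j => sp j k w)) => //.
  rewrite RintegralD//; last exact: Int_F.
  rewrite [X in _ <= X -> _]RintegralD//.
  rewrite [X in _ <= X + _ -> _]RintegralB//; last exact: Int_F.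
  rewrite !RintegralZl//; [|exact: IntZ|exact: Int_sqr_grad|by apply: IntZ; exact: Int_sqr_grad].
  rewrite Rintegral_sum; last by move=> j; apply: IntZ; exact: Int_grad_delta.
  (* One factor [beta k] comes from the stepsize and the other from [bias]. *)
  have : - \sum_j \int[P]_w (a j k * (grad (x k w) 0 j * delta j k w)) <=
      n%:R * (c1 * `|Cb|) * beta k ^+ 2.
    rewrite -sumrN -mulrA -sumr_const_ord; apply: ler_sum => j _.
    rewrite RintegralZl//; last exact: Int_grad_delta.
    rewrite -mulrN; apply: le_trans (ler_norm _) _; rewrite normrM normrN.
    have /andP[a1 a2] := a_bounds j k.
    have a0 : 0 <= a j k by apply: le_trans a1; rewrite mulr_ge0// ltW.
    rewrite (ger0_norm a0) expr2 mulrACA ler_pM//.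
    apply: le_trans (bias j k) _; rewrite ler_wpM2r ?ler_norm// ltW//.
  have : descent_const F L c1 * (beta k ^+ 2 * \int[P]_w W k w) <=
      descent_const F L c1 * (beta k ^+ 2 * Cw).
    by do 2 (rewrite ler_wpM2l ?sqr_ge0//).
  have : 0 <= var_const F L c1 * Cw * beta k ^+ 2.
    by apply: mulr_ge0; [exact: mulr_ge0 | exact: sqr_ge0].
  rewrite /C; lra.
- move=> k; rewrite -RintegralB//; [|exact: Int_sqr_grad|exact: Int_sqr_grad].
  apply: le_trans (le_normr_Rintegral _ _) _ => //.
    by apply: IntB; exact: Int_sqr_grad.
  have : \int[P]_w `|enorm (grad (x k.+1 w)) ^+ 2 - enorm (grad (x k w)) ^+ 2| <=
      \int[P]_w (var_const F L c1 * (beta k * W k w)).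
    apply: le_Rintegral => //.
    + by apply: Int_norm; apply: IntB; exact: Int_sqr_grad.
    + by apply: IntZ; exact: IntZ.
    + move=> w _; apply: (@step_variation _ _ _ _ _ _ L_ge0 F_lip c0_ge0 c1_ge0
        _ _ (fun j => sp j k w) (fun j => a j k)) => //.
  rewrite !RintegralZl//; last exact: IntZ.
  have : var_const F L c1 * (beta k * \int[P]_w W k w) <=
      var_const F L c1 * (beta k * Cw).
    by rewrite ler_wpM2l// ler_wpM2l// ltW.
  have : 0 <= descent_const F L c1 * Cw * beta k.
    by apply: mulr_ge0; [exact: mulr_ge0 | exact: ltW].
  have : 0 <= n%:R * (c1 * `|Cb|) * beta k by rewrite !mulr_ge0// ltW.
  rewrite /C; lra.
Qed.

End StochasticDescent.

(** * Almost sure domination and Jensen's inequality for the square *)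

Section Bounds.
Context {R : realType} {d : measure_display} {T : measurableType d}
  (P : probability T R).
Local Notation Int X := (P.-integrable setT (EFin \o X)).

(** Meant for products with a conditional expectation, whose bound holds only almost surely. *)
Lemma ae_dominated_Rintegral (X Y : T -> R) : measurable_fun setT X -> Int Y ->
    (forall w, 0 <= Y w) -> {ae P, forall w, `|X w| <= Y w} ->
  Int X /\ `|\int[P]_w X w| <= \int[P]_w Y w.
Proof.
move=> mX iY Y_ge0 XY.
have le_int : (\int[P]_w `|X w|%:E <= \int[P]_w (Y w)%:E)%E.
  apply: ae_ge0_le_integral => //.
  - exact/measurable_EFinP/measurableT_comp.
  - by move=> w _; rewrite lee_fin.
  - exact: measurable_int iY.
  - by apply: filterS XY => w + _; rewrite lee_fin.
have iX : Int X.
  apply/integrableP; split; first exact/measurable_EFinP.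
  apply: le_lt_trans le_int _; rewrite -ge0_fin_numE.
    exact: integrable_fin_num.
  by apply: integral_ge0 => w _; rewrite lee_fin.
split=> //; apply: le_trans (le_normr_Rintegral _ iX) _ => //.
rewrite -lee_fin /Rintegral !fineK//; first exact: integrable_fin_num.
exact: (integrable_fin_num _ (Int_norm iX)).
Qed.

(** Expand the nonnegative integral of [(X - a) ^+ 2], where [a] is the mean of [X]. *)
Lemma Rintegral_le_sqrt (X : T -> R) : Int X -> Int (fun w => X w ^+ 2) ->
  \int[P]_w X w <= Num.sqrt (\int[P]_w (X w ^+ 2)).
Proof.
move=> iX iX2; set a := \int[P]_w X w.
apply: le_trans (ler_norm a) _; rewrite -sqrtr_sqr ler_sqrt; last first.
  by apply: Rintegral_ge0 => w _; exact: sqr_ge0.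
have : 0 <= \int[P]_w (X w ^+ 2 - 2 * a * X w + a ^+ 2).
  apply: Rintegral_ge0 => w _.
  by rewrite (_ : _ + _ = (X w - a) ^+ 2) ?sqr_ge0//; ring.
rewrite RintegralD//; [|by apply: IntB => //; exact: IntZ|exact: Int_cst].
rewrite RintegralB//; last exact: IntZ.
rewrite RintegralZl// Rintegral_probability_cst -/a; lra.
Qed.

End Bounds.

(** * Real bounds extracted from extended suprema and infima *)

Section UniformBounds.
Context {R : realType}.

Lemma ereal_sup_lty_ubound (u : nat -> R) :
  (ereal_sup (range (fun k => (u k)%:E)) < +oo)%E -> exists M, forall k, u k <= M.
Proof.
set e := ereal_sup _ => ey.
have ue k : ((u k)%:E <= e)%E by apply: ereal_sup_ubound; exists k.
case: e ey ue => [r _ ue|//|_ ue]; last by have := ue 0%N.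
by exists r => k; rewrite -lee_fin.
Qed.

Lemma ereal_inf_gt0_lbound (u : nat -> R) :
  (0 < ereal_inf (range (fun k => (u k)%:E)))%E ->
  exists2 m, 0 < m & forall k, m <= u k.
Proof.
set e := ereal_inf _ => e0.
have ue k : (e <= (u k)%:E)%E by apply: ereal_inf_lbound; exists k.
case: e e0 ue => [r r0 ue|_ ue|//]; last by have := ue 0%N.
by exists r => // k; rewrite -lee_fin.
Qed.

End UniformBounds.

(** * Block coordinates: [sig1 q] is the block of the coordinate [q], [sig2 q] its place in that
    block *)

Section Blocks.
Context {R : realType} (s : nat) (n_ : 'I_s -> nat).
Local Notation vec := 'rV[R]_(\sum_i n_ i).
Implicit Types (v x y : vec).
Import tagnat.

Lemma submxrow_coord v q : v 0 q = submxrow v (sig1 q) 0 (sig2 q).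
Proof. by rewrite mxE sig2K. Qed.

Lemma splice_coord i y x q :
  splice i y x 0 q = if (sig1 q < i)%N then y 0 q else x 0 q.
Proof. by rewrite mxE; case: ifP => _; rewrite mxE sig2K. Qed.

Lemma block_grad_coord (h : vec -> R) x q :
  block_grad (sig1 q) h x 0 (sig2 q) = gradient h x 0 q.
Proof. by rewrite /block_grad -submxrow_coord. Qed.

End Blocks.

(** * Measurability of the iterates for the past mini-batches *)

Section History.
Context {R : realType} {d d' : measure_display}
  {Omega : measurableType d} {S : measurableType d'} {P : probability Omega R}
  (s : nat) (n_ : 'I_s -> nat).
Local Notation vec := 'rV[R]_(\sum_i n_ i).
Variables (m : nat -> nat) (xis : forall k, 'I_(m k) -> {RV P >-> S}).
Variables (f : vec -> S -> R) (x : nat -> Omega -> vec).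
Variables (x1 : vec) (alpha : 'I_s -> nat -> R).
Import tagnat.

(** The generating family of [history k], named so that the lemmas on [<<s G>>] apply to it. *)
Definition draws k : set (set Omega) :=
  [set A | exists (j : nat) (l : 'I_(m j)) (B : set S),
     [/\ (j < k)%N, measurable B & A = xis l @^-1` B]].

Local Notation H k := (g_sigma_algebraType (draws k)).

Lemma draws_measurable k A : draws k A -> measurable A.
Proof.
move=> [j [l [B [_ mB ->]]]]; rewrite -[X in measurable X]setTI.
exact: (measurable_funPT (xis l)).
Qed.

Lemma measurable_historyS k d2 (S' : measurableType d2) (h : Omega -> S') :
  measurable_fun [set: H k] (h : H k -> S') ->
  measurable_fun [set: H k.+1] (h : H k.+1 -> S').
Proof.
move=> mh _ B mB.
have : <<s draws k>> (setT `&` h @^-1` B) by exact: mh.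
apply: sub_sigma_algebra2 => _ [j [l [C [jk mC ->]]]].
by exists j, l, C; split => //; exact: ltnW.
Qed.

Lemma draw_measurable_history k (l : 'I_(m k)) :
  measurable_fun [set: H k.+1] (xis l : H k.+1 -> S).
Proof.
move=> _ B mB; rewrite setTI; apply: sub_sigma_algebra.
by exists k, l, B.
Qed.

Hypothesis f_meas : forall z, measurable_fun setT (f z).
Hypothesis f_diff : forall u z, differentiable (f^~ u) z.
Hypothesis x_bsg : is_bsg xis f x x1 alpha.
Hypothesis alpha_gt0 : forall i k, 0 < alpha i k.

Lemma bsg_coord k w q : x k.+1 w 0 q = x k w 0 q - alpha (sig1 q) k *
  stoch_block_grad xis f x (sig1 q) k w 0 (sig2 q).
Proof.
have /(prox_stepP _ _ _ (alpha_gt0 (sig1 q) k)) := x_bsg.2 k (sig1 q) w.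
move/(congr1 (fun v : 'rV[R]_(n_ (sig1 q)) => v 0 (sig2 q))).
rewrite -submxrow_coord => ->; rewrite [LHS]mxE [X in _ + X]mxE -submxrow_coord.
by rewrite [X in _ - X]mxE.
Qed.

(** By induction on [k]: the start is constant, and the update combines [x k], the mini-batch [k]
    and the blocks already updated, all measurable for the history [k.+1]. *)
Lemma iterate_measurable_history k q :
  measurable_fun [set: H k] (fun w : H k => x k w 0 q).
Proof.
elim: k q => [|k IH] q.
  by under eq_fun do rewrite x_bsg.1; exact: measurable_cst.
have {}IH r : measurable_fun [set: H k.+1] (fun w : H k.+1 => x k w 0 r).
  exact: (measurable_historyS (IH r)).
(* Strong induction on the block number: the spliced point takes from [x k.+1] only the blocks
   before [sig1 q]. *)
have [N] := ubnP (sig1 q : nat); elim: N q => // N IHN q /ltnSE qN.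
under eq_fun do rewrite bsg_coord.
apply: measurable_funB => //; apply: measurable_funM => //.
rewrite (_ : (fun w => _) = (fun w : H k.+1 => (m k)%:R^-1 *
    \sum_(l < m k) gradient (f^~ (xis l w))
       (splice (sig1 q) (x k.+1 w) (x k w)) 0 q)); last first.
  apply/funext => w; rewrite mxE summxE; congr (_ * _); apply: eq_bigr => l _.
  exact: block_grad_coord.
apply: measurable_funM => //; apply: measurable_sum => l.
apply: (@measurable_gradient R _ _ (H k.+1) S _ f
  (fun w => splice (sig1 q) (x k.+1 w) (x k w)) (xis l)) => //; last first.
  exact: draw_measurable_history.
move=> r; under eq_fun do rewrite splice_coord.
have [rq|_] := ltnP (sig1 r) (sig1 q); last exact: IH.
by apply: IHN; apply: leq_trans qN.
Qed.

End History.

(** * Reduction of the block method to the coordinatewise result *)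

Theorem theorem5 (R : realType) (d d' : measure_display)
    (Omega : measurableType d) (S : measurableType d') (P : probability Omega R)
    (s : nat) (n_ : 'I_s -> nat)
    (xi : {RV P >-> S}) (f : 'rV[R]_(\sum_i n_ i) -> S -> R)
    (F : 'rV[R]_(\sum_i n_ i) -> R)
    (m : nat -> nat) (xis : forall k, 'I_(m k) -> {RV P >-> S})
    (c : 'I_s -> nat -> R) (beta : nat -> R) (alpha : 'I_s -> nat -> R)
    (x1 : 'rV[R]_(\sum_i n_ i)) (x : nat -> Omega -> 'rV[R]_(\sum_i n_ i))
    (A L rho : R) (sigma : nat -> R)
    (f_meas : forall z, measurable_fun setT (f z))
    (f_int : forall z, P.-integrable setT (fun w => (f z (xi w))%:E))
    (f_diff : forall u z, differentiable (f^~ u) z)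
    (F_def : forall z, (F z)%:E = ('E_P[fun w => f z (xi w)])%E)
    (F_diff : forall z, differentiable F z)
    (F_C1 : continuous (gradient F))
    (m_gt0 : forall k, (0 < m k)%N)
    (xis_law : forall k (l : 'I_(m k)) (B : set S), measurable B ->
       distribution P (xis k l) B = distribution P xi B)
    (x_bsg : is_bsg xis f x x1 alpha)
    (alphaE : forall i k, alpha i k = c i k * beta k)
    (c_gt0 : forall i k, 0 < c i k)
    (beta_gt0 : forall k, 0 < beta k)
    (beta_noninc : forall k, beta k.+1 <= beta k)
    (c_inf : forall i, (0 < ereal_inf (range (fun k => (c i k)%:E)))%E)
    (c_sup : forall i, (ereal_sup (range (fun k => (c i k)%:E)) < +oo)%E)
    (beta_sum : (\sum_(0 <= k <oo) (beta k)%:E = +oo)%E)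
    (beta2_sum : (\sum_(0 <= k <oo) (beta k ^+ 2)%:E < +oo)%E)
    (delta_bias : forall i k, exists D : Omega -> 'rV[R]_(n_ i),
       is_cond_expv P (history xis k) (grad_error xis f x F i k) D /\
       {ae P, forall w, enorm (D w) <= A * \big[Num.max/0]_j alpha j k})
    (sigma_ge0 : forall k, 0 <= sigma k)
    (delta_var : forall i k,
       ('E_P[fun w => (enorm (grad_error xis f x F i k w) ^+ 2)%R]
        <= (sigma k ^+ 2)%:E)%E)
    (F_lbound : exists b : R, forall z, b <= F z)
    (L_gt0 : 0 < L)
    (F_lip : forall i y z,
       enorm (block_grad i F y - block_grad i F z) <= L * enorm (y - z))
    (x_bounded : forall k, ('E_P[fun w => (enorm (x k w) ^+ 2)%R] <= (rho ^+ 2)%:E)%E)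
    (sigma_sup : (ereal_sup (range (fun k => (sigma k)%:E)) < +oo)%E) :
  ('E_P[fun w => enorm (gradient F (x k w))] @[k --> \oo] --> 0)%E.
Proof.
have alpha_gt0 i k : 0 < alpha i k by rewrite alphaE mulr_gt0.
have [c0 c0_gt0 c0P] : exists2 c0, 0 < c0 & forall i k, c0 <= c i k.
  have /choice[mc mcP] : forall i, exists mc, 0 < mc /\ forall k, mc <= c i k.
    by move=> i; have [mc mc0 mcc] := ereal_inf_gt0_lbound (c_inf i); exists mc.
  (* The default 1 keeps the minimum positive even without blocks; the default 0 of the maximum
     below makes [c1] nonnegative. *)
  exists (\big[Num.min/1]_i mc i).
    by apply: lt_bigmin => // i _; exact: (mcP i).1.
  by move=> i k; apply: le_trans ((mcP i).2 k); exact: bigmin_le.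
have [c1 c1_ge0 c1P] : exists2 c1, 0 <= c1 & forall i k, c i k <= c1.
  have /choice[Mc McP] : forall i, exists Mc, forall k, c i k <= Mc.
    by move=> i; exact: ereal_sup_lty_ubound (c_sup i).
  exists (\big[Num.max/0]_i Mc i); first exact: bigmax_ge_id.
  by move=> i k; apply: le_trans (McP i k) _; exact: le_bigmax.
have [sg sgP] := ereal_sup_lty_ubound sigma_sup.
have [lb lbP] := F_lbound.
(* From here on each coordinate counts as its own block, with the stepsize and the spliced point of
   the block that contains it. *)
pose N := (\sum_i n_ i)%N.
pose a (q : 'I_N) k := alpha (tagnat.sig1 q) k.
pose delta (q : 'I_N) k w :=
  grad_error xis f x F (tagnat.sig1 q) k w 0 (tagnat.sig2 q).
pose sp (q : 'I_N) k w := splice (tagnat.sig1 q) (x k.+1 w) (x k w).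
have F_lip1 (q : 'I_N) y z :
    `|gradient F y 0 q - gradient F z 0 q| <= L * enorm (y - z).
  apply: le_trans (F_lip (tagnat.sig1 q) y z).
  have -> : gradient F y 0 q - gradient F z 0 q =
      (block_grad (tagnat.sig1 q) F y - block_grad (tagnat.sig1 q) F z)
        0 (tagnat.sig2 q).
    by rewrite [RHS]mxE [X in _ = _ + X]mxE !block_grad_coord.
  exact: coord_le_enorm.
have draws_meas k := @draws_measurable _ _ _ Omega S P m xis k.
have x_meas k q : measurable_fun setT (fun w => x k w 0 q).
  apply: (g_sigma_measurable_fun (@draws_meas k)).
  exact: (iterate_measurable_history f_meas f_diff x_bsg alpha_gt0).
have delta_meas q k : measurable_fun setT (delta q k).
  (* Integrability, and with it measurability, of the noise is part of having a conditional
     expectation. *)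
  have [D [/(_ (tagnat.sig2 q))[iD _ _ _] _]] := delta_bias (tagnat.sig1 q) k.
  exact: Int_measurable iD.
have sqr_int n (X : Omega -> 'rV[R]_n) (r : R) :
    (forall j, measurable_fun setT (fun w => X w 0 j)) ->
    ('E_P[fun w => (enorm (X w) ^+ 2)%R] <= r%:E)%E ->
    P.-integrable setT (EFin \o (fun w => enorm (X w) ^+ 2)) /\
    \int[P]_w (enorm (X w) ^+ 2) <= r.
  move=> mX EX.
  have iX : P.-integrable setT (EFin \o (fun w => enorm (X w) ^+ 2)).
    apply: expectation_fin_Int EX; last by move=> w; exact: sqr_ge0.
    under eq_fun do rewrite sqr_enorm.
    by apply: measurable_sum => j; exact: measurable_funX.
  by split=> //; rewrite -lee_fin -expectation_Rintegral.
have x_int k := sqr_int _ _ _ (x_meas k) (x_bounded k).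
have delta_sqr q k : P.-integrable setT (EFin \o (fun w => delta q k w ^+ 2)) /\
    \int[P]_w (delta q k w ^+ 2) <= sg ^+ 2.
  have [||ie le_e] := sqr_int _ (grad_error xis f x F (tagnat.sig1 q) k) (sg ^+ 2).
  - move=> j; have [D [/(_ j)[iD _ _ _] _]] := delta_bias (tagnat.sig1 q) k.
    exact: Int_measurable iD.
  - apply: le_trans (delta_var _ _) _; rewrite lee_fin ler_sqr ?nnegrE//.
    exact: le_trans (sigma_ge0 k) (sgP k).
  have de w : delta q k w ^+ 2 <= enorm (grad_error xis f x F (tagnat.sig1 q) k w) ^+ 2.
    exact: sqr_coord_le_enorm.
  have id : P.-integrable setT (EFin \o (fun w => delta q k w ^+ 2)).
    apply: Int_dominated ie _; first exact: measurable_funX.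
    by move=> w; rewrite ger0_norm ?sqr_ge0.
  by split=> //; apply: le_trans le_e; apply: le_Rintegral.
have L_ge0 := ltW L_gt0.
(* [K * beta k] bounds the conditional bias, since all stepsizes are at most [c1 * beta k]; [A] may
   be negative. *)
pose K := `|A| * c1.
have K_ge0 : 0 <= K by rewrite mulr_ge0.
(* With [h] the gradient coordinate and [D] the conditional bias, the product [h * D] is at most
   [K * beta k * (1 + h ^+ 2)] in absolute value, and [h ^+ 2] has mean at most
   [growth F L * (1 + rho ^+ 2)]. *)
have bias q k : `|\int[P]_w (gradient F (x k w) 0 q * delta q k w)| <=
    (1 + growth F L * (1 + rho ^+ 2)) * K * beta k.
  have [D [/(_ (tagnat.sig2 q)) condD D_le]] := delta_bias (tagnat.sig1 q) k.
  have [idelta iD mD _] := condD.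
  have iG := Int_sqr_grad_coord F_C1 L_ge0 F_lip1 x_meas (fun k => (x_int k).1) k q.
  have mG := measurable_grad F_C1 x_meas k q.
  set h := fun w => gradient F (x k w) 0 q in iG mG *.
  have Kb0 : 0 <= K * beta k by rewrite mulr_ge0// ltW.
  have D_bound : {ae P, forall w, `|D w 0 (tagnat.sig2 q)| <= K * beta k}.
    apply: filterS D_le => w Dw; apply: le_trans (le_trans (coord_le_enorm _ _) Dw) _.
    apply: (@le_trans _ _ (`|A| * \big[Num.max/0]_j alpha j k)).
      by rewrite ler_wpM2r ?ler_norm// bigmax_ge_id.
    rewrite /K -mulrA ler_wpM2l//; apply/bigmax_leP; split.
      by rewrite mulr_ge0// ltW.
    by move=> i _; rewrite alphaE ler_wpM2r// ltW.
  have ihd : P.-integrable setT (EFin \o (fun w => h w * delta q k w)).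
    exact: (Int_grad_delta F_C1 L_ge0 F_lip1 x_meas delta_meas (fun k => (x_int k).1)
      (fun q k => (delta_sqr q k).1)).
  have [||||ihD hD_le] := @ae_dominated_Rintegral _ _ _ P
    (fun w => h w * D w 0 (tagnat.sig2 q)) (fun w => K * beta k * (1 + h w ^+ 2)).
  - by apply: measurable_funM => //; exact: Int_measurable iD.
  - by apply: IntZ; apply: IntD => //; exact: Int_cst.
  - by move=> w; rewrite mulr_ge0// addr_ge0// sqr_ge0.
  - apply: filterS D_bound => w Dw; rewrite normrM mulrC ler_pM//.
    rewrite -[X in 1 + X]real_normK ?num_real//; have := sqr_ge0 (`|h w| - 1).
    by have := sqr_ge0 `|h w|; nra.
  (* Only [gradient F (x k)], not the gradient at the spliced point, is
     measurable for the history. *)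
  rewrite (Rintegral_pull_out (@draws_meas k) condD)//; last first.
    apply: (measurable_continuous_vec (h := fun z => gradient F z 0 q)).
      exact: continuous_gradient_coord.
    exact: (iterate_measurable_history f_meas f_diff x_bsg alpha_gt0).
  apply: le_trans hD_le _.
  rewrite RintegralZl//; last by apply: IntD => //; exact: Int_cst.
  rewrite RintegralD//; last exact: Int_cst.
  rewrite Rintegral_probability_cst -mulrA [leRHS]mulrC ler_wpM2l// lerD2l.
  apply: (@le_trans _ _ (\int[P]_w (growth F L * (1 + enorm (x k w) ^+ 2)))).
    apply: le_Rintegral => //.
      by apply: IntZ; apply: IntD; [exact: Int_cst|exact: (x_int k).1].
    by move=> w _; exact: grad_growth.
  have ix := (x_int k).1; have i1 := Int_cst P (1 : R).
  rewrite RintegralZl//; last exact: IntD.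
  rewrite RintegralD// Rintegral_probability_cst ler_wpM2l ?growth_ge0// lerD2l.
  exact: (x_int k).2.
have a_bounds (q : 'I_N) k : c0 * beta k <= a q k <= c1 * beta k.
  by rewrite /a alphaE !ler_wpM2r ?c0P ?c1P// ltW.
have sp_between (q r : 'I_N) k w :
    `|sp q k w 0 r - x k w 0 r| <= `|x k.+1 w 0 r - x k w 0 r|.
  by rewrite splice_coord; case: ifP => // _; rewrite subrr normr0.
have x_step (q : 'I_N) k w : x k.+1 w 0 q =
    x k w 0 q - a q k * (gradient F (sp q k w) 0 q + delta q k w).
  rewrite (bsg_coord x_bsg alpha_gt0) /delta /grad_error; congr (_ - _ * _).
  by rewrite [X in _ + X]mxE [X in _ + (_ + X)]mxE block_grad_coord addrC subrK.
have B0 := stochastic_descent_cvg0 F_diff F_C1 L_ge0 F_lip1 lbP c0_gt0 c1_ge0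
  beta_gt0 a_bounds sp_between x_step x_meas delta_meas (fun k => (x_int k).1)
  (fun k => (x_int k).2) (fun q k => (delta_sqr q k).1)
  (fun q k => (delta_sqr q k).2) bias beta_sum beta2_sum.
have iG2 k := Int_sqr_grad F_C1 L_ge0 F_lip1 x_meas (fun k => (x_int k).1) k.
have iG k : P.-integrable setT (EFin \o (fun w => enorm (gradient F (x k w)))).
  apply: (Int_dominated (Y := fun w => 1 + enorm (gradient F (x k w)) ^+ 2)).
  - apply: (@measurableT_comp _ _ _ _ _ _ (Num.sqrt : R -> R) setT
      (fun w => \sum_q gradient F (x k w) 0 q ^+ 2)).
      by apply: continuous_measurable_fun; exact: sqrt_continuous.
    apply: measurable_sum => q; apply: measurable_funX.
    exact: measurable_grad.
  - by apply: IntD => //; exact: Int_cst.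
  - move=> w; set e := enorm _; rewrite ger0_norm ?enorm_ge0//.
    by have := sqr_ge0 (e - 1); have := sqr_ge0 e; nra.
under eq_fun do rewrite expectation_Rintegral//.
apply: cvg_EFin; first exact: nearW.
(* The mean of the norm lies between 0 and the square root of the mean square, which tends to 0 by
   [B0]. *)
apply: (@squeeze_cvgr _ _ _ _ (fun=> 0)
  (fun k => Num.sqrt (\int[P]_w (enorm (gradient F (x k w)) ^+ 2)))).
- apply: nearW => k; rewrite Rintegral_le_sqrt ?andbT//.
  by apply: Rintegral_ge0 => w _; exact: enorm_ge0.
- exact: cvg_cst.
- by rewrite -[X in _ --> X]sqrtr0; apply: continuous_cvg => //; exact: sqrt_continuous.
Qed.
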